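(* Let $\mathsf{Ab}$ be the pseudovariety of all finite Abelian groups and $\mathsf{Com}$ the pseudovariety of all finite commutative semigroups. Let $\mathsf V$ be any pseudovariety of semigroups such that $\mathsf{Ab}\subseteq\mathsf V\subseteq\mathsf{Com}$. Then $\mathsf V$ is not $\omega$-reducible (for the equation $x=y$), where $\omega$ denotes the implicit signature consisting of binary multiplication and the unary $\omega$-power $x\mapsto x^\omega$.
   Context: A pseudovariety of semigroups is a class of finite semigroups closed under taking subsemigroups, homomorphic images and finite direct products. For a finite set $A$, $\overline{\Omega}_A\mathsf S$ denotes the free profinite semigroup on $A$ (the pro-$\mathsf S$ semigroup freely generated by $A$, where $\mathsf S$ is the class of all finite semigroups); its elements are called pseudowords, and the free semigroup $A^+$ is a dense subsemigroup. Each $w\in\overline{\Omega}_A\mathsf S$ is interpreted in a profinite semigroup $S$ as the $A$-ary operation $w_S:S^A\to S$, $w_S(\varphi)=\hat\varphi(w)$, where $\hat\varphi:\overline{\Omega}_A\mathsf S\to S$ is the unique continuous homomorphism extending $\varphi:A\to S$. In particular $x^\omega=\lim_{n\to\infty}x^{n!}$. For $u,v\in\overline{\Omega}_A\mathsf S$ and a pseudovariety $\mathsf V$, $\mathsf V\models u=v$ means $u_S=v_S$ for all $S\in\mathsf V$. An implicit signature $\sigma$ is a set of pseudowords (over finite alphabets) that includes binary multiplication. For a finite set $A$, $\Omega^\sigma_A\mathsf S$ is the $\sigma$-subalgebra of $\overline{\Omega}_A\mathsf S$ generated by $A$, i.e. the smallest subset containing $A$ and closed under all operations in $\sigma$; its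 elements are called $\sigma$-words. Given a pseudovariety $\mathsf V$, a finite semigroup $S$, elements $s,t\in S$, and an onto continuous homomorphism $\varphi:\overline{\Omega}_A\mathsf S\to S$ with $A$ finite, a $\mathsf V$-solution of the equation $x=y$ for the triple $(S,s,t)$ is a pair $u,v\in\overline{\Omega}_A\mathsf S$ such that $\mathsf V\models u=v$, $\varphi(u)=s$ and $\varphi(v)=t$. The pseudovariety $\mathsf V$ is $\sigma$-reducible (for the equation $x=y$) if, whenever there is a $\mathsf V$-solution for a triple $(S,s,t)$, there is a $\mathsf V$-solution $(u,v)$ for it with both $u$ and $v$ $\sigma$-words (over the same $A$, with respect to the same $\varphi$). This property is independent of the choice of the onto continuous homomorphism $\varphi$. *)

(* Defs.v *)
From HB Require Import structures.
From mathcomp Require Import all_boot.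
From mathcomp Require Import monoid.
From mathcomp Require Import boolp classical_sets functions cardinality.
From mathcomp Require Import topology.

Set Implicit Arguments.
Unset Strict Implicit.
Unset Printing Implicit Defensive.

Local Open Scope classical_set_scope.
Local Open Scope group_scope.

#[short(type="finSemigroupType")]
HB.structure Definition FinSemigroup := {S of Finite S & Semigroup S}.

HB.instance Definition _ (T : semigroupType) :=
  Semigroup.copy (discrete_topology T) T.

HB.instance Definition _ (T : finSemigroupType) :=
  Finite.copy (discrete_topology T) T.

(* Compact semigroups that are residually finite, i.e. whose points are
   separated by the continuous homomorphisms into finite discrete semigroups.
   Being compact includes being Hausdorff. *)
HB.mixin Record isProfinite S of Topological S & Semigroup S := {
  mulg_continuous : continuous (fun xy : S * S => xy.1 * xy.2);
  profinite_compact : compact [set: S];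
  profinite_hausdorff : hausdorff_space S;
  profinite_residual : forall x y : S, x <> y ->
    exists (T : finSemigroupType) (h : S -> discrete_topology T),
      [/\ continuous h, {morph h : u v / u * v} & h x <> h y]
}.

#[short(type="profiniteSemigroupType")]
HB.structure Definition ProfiniteSemigroup :=
  {S of isProfinite S & Topological S & Semigroup S}.

Section Discrete.
Variable T : finSemigroupType.
Local Notation D := (discrete_topology T).

Lemma discrete_mul_continuous : continuous (fun xy : D * D => xy.1 * xy.2).
Proof.
move=> [x y] U /= /nbhs_singleton Uxy.
exists ([set x], [set y]) => /=; first by split; exact: discrete_set1.
by move=> [a b] /= [-> ->].
Qed.

Lemma discrete_compact : compact [set: D].
Proof. exact/finite_compact/finite_finset. Qed.

Lemma discrete_residual (x y : D) : x <> y ->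
  exists (T' : finSemigroupType) (h : D -> discrete_topology T'),
    [/\ continuous h, {morph h : u v / u * v} & h x <> h y].
Proof. by move=> xy; exists T, id; split=> // z. Qed.

HB.instance Definition _ := isProfinite.Build D
  discrete_mul_continuous discrete_compact discrete_hausdorff discrete_residual.
End Discrete.

Section Profinite.
Variable S : profiniteSemigroupType.

Lemma profinite_eq (x y : S) :
  (forall (T : finSemigroupType) (h : S -> discrete_topology T),
     continuous h -> {morph h : u v / u * v} -> h x = h y) -> x = y.
Proof.
move=> hxy; apply: contrapT => /profinite_residual[T [h [hc hm]]].
by apply; exact: hxy.
Qed.

Lemma profinite_cvg (G : set_system S) : ProperFilter G ->
  (forall (T : finSemigroupType) (h : S -> discrete_topology T),
     continuous h -> {morph h : u v / u * v} ->
     exists t, G (h @^-1` [set t])) ->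
  exists x : S, G --> x.
Proof.
move=> PG HG.
have [x [_ clx]] := @profinite_compact S G PG filterT.
exists x; apply: (@compact_cluster_set1 S x G setT) => //.
- exact: profinite_hausdorff.
- exact: profinite_compact.
- exact: filterT.
- exact: filterT.
rewrite eqEsubset; split=> [y cly|_ -> //].
apply: profinite_eq => T h hc hm; have [t Gt] := HG T h hc hm.
have cl z : cluster G z -> h z = t.
  move=> clz; have : nbhs z (h @^-1` [set h z]).
    by apply: hc; exact: discrete_set1.
  by move=> /(clz _ _ Gt)[u [/= <- ->]].
by rewrite (cl _ clx) (cl _ cly).
Qed.

Lemma profinite_cvg_to (G : set_system S) (x : S) : ProperFilter G ->
  (forall (T : finSemigroupType) (h : S -> discrete_topology T),
     continuous h -> {morph h : u v / u * v} -> G (h @^-1` [set h x])) ->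
  G --> x.
Proof.
move=> PG HG; have [T h hc hm|y Gy] := profinite_cvg PG.
  by exists (h x); exact: HG.
suff -> : x = y by [].
apply: profinite_eq => T h hc hm.
have /Gy Gh : nbhs y (h @^-1` [set h y]).
  by apply: hc; exact: discrete_set1.
by have [u [/= <- ->]] := filter_ex (filterI (HG T h hc hm) Gh).
Qed.

End Profinite.

(* The free semigroup: (a, s) stands for the nonempty word a :: s. *)
Definition word (A : Type) := (A * seq A)%type.

HB.instance Definition _ (A : choiceType) :=
  Choice.copy (word A) (A * seq A)%type.

Definition word_cat (A : Type) (u v : word A) : word A :=
  (u.1, u.2 ++ v.1 :: v.2).

Lemma word_catA (A : Type) : associative (@word_cat A).
Proof. by move=> [a u] [b v] [c w]; rewrite /word_cat /= -catA. Qed.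

HB.instance Definition _ (A : choiceType) :=
  isSemigroup.Build (word A) (@word_catA A).

Definition word_eval (A : Type) (S : semigroupType) (f : A -> S) (w : word A)
  : S := foldl (fun x a => x * f a) (f w.1) w.2.

Lemma word_evalM (A : choiceType) (S : semigroupType) (f : A -> S) :
  {morph word_eval f : u v / u * v}.
Proof.
move=> [a u] [b v]; rewrite /word_eval /= foldl_cat /=.
elim/last_ind: v => [//|v c IH].
by rewrite !foldl_rcons IH mulgA.
Qed.

Lemma morph_word_eval (A : choiceType) (S T : semigroupType) (h : S -> T)
    (f : A -> S) (w : word A) : {morph h : x y / x * y} ->
  h (word_eval f w) = word_eval (h \o f) w.
Proof.
move=> hm; case: w => a u; rewrite /word_eval /=.
by elim/last_ind: u => [//|u c IH]; rewrite !foldl_rcons hm IH.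
Qed.

(* An A-indexed family of elements of a finite semigroup; carriers of the form
   'I_n represent all finite semigroups up to isomorphism, and they keep the
   collection of all such families small. *)
Record pointing (A : Type) := Pointing {
  pt_size : nat;
  pt_mul : 'I_pt_size -> 'I_pt_size -> 'I_pt_size;
  pt_mulA : associative pt_mul;
  pt_gen : A -> 'I_pt_size
}.

HB.instance Definition _ (A : Type) := gen_eqMixin (pointing A).

Definition pt_sort (A : Type) (i : pointing A) := 'I_(pt_size i).

HB.instance Definition _ (A : Type) (i : pointing A) :=
  Finite.on (pt_sort i).
HB.instance Definition _ (A : Type) (i : pointing A) :=
  isSemigroup.Build (pt_sort i) (@pt_mulA A i).

Definition pt_prod (A : Type) :=
  prod_topology (fun i : pointing A => discrete_topology (pt_sort i)).

HB.instance Definition _ (A : Type) := Topological.on (pt_prod A).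

Definition pt_prod_mul (A : Type) (x y : pt_prod A) : pt_prod A :=
  fun i => x i * y i.

Lemma pt_prod_mulA (A : Type) : associative (@pt_prod_mul A).
Proof.
move=> x y z; apply: functional_extensionality_dep => i.
exact: (@mulgA (pt_sort i)).
Qed.

HB.instance Definition _ (A : Type) :=
  isSemigroup.Build (pt_prod A) (@pt_prod_mulA A).

Definition pt_letter (A : Type) (a : A) : pt_prod A := fun i => pt_gen i a.

(* The free profinite semigroup on A, as the closure of (the image of) A^+ in
   the product of all finite semigroups with a distinguished A-indexed family
   of elements; see pw_lift_exists and pw_lift_unique for its universal property. *)
Definition pseudoword_set (A : Type) : set (pt_prod A) :=
  closure (range (word_eval (@pt_letter A))).

Definition pseudoword (A : finType) : Type := set_type (@pseudoword_set A).
HB.instance Definition _ (A : finType) := Topological.on (pseudoword A).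

Section FreeProfinite.
Variable A : finType.

Lemma pt_prod_cvg (F : set_system (pt_prod A)) (x : pt_prod A) : Filter F ->
  (forall i, F [set y | y i = x i]) -> F --> x.
Proof.
move=> FF Fx; apply/cvg_sup => i U [_ [[W _ <-] Wx] WU].
by apply: filterS (Fx i) => y /= yx; apply: WU; rewrite /= yx.
Qed.

Lemma nbhs_pt_prod (x : pt_prod A) i : nbhs x [set y | y i = x i].
Proof.
exact: (@proj_continuous (pointing A)
  (fun i => discrete_topology (pt_sort i)) i x [set x i] (discrete_set1 _)).
Qed.

Lemma pseudoword_set_mul (x y : pt_prod A) :
  pseudoword_set x -> pseudoword_set y -> pseudoword_set (x * y).
Proof.
move=> cx cy U nU.
have : (fun xy : pt_prod A * pt_prod A => xy.1 * xy.2) @ (x, y) --> x * y.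
  apply: pt_prod_cvg => i.
  exists ([set z | z i = x i], [set z | z i = y i]).
    by split; exact: nbhs_pt_prod.
  by move=> [a b] /= [ax bx]; rewrite /mul /= /pt_prod_mul ax bx.
move=> /(_ _ nU)[[P Q] /= [/cx[a [[u _ <-] Pa]] /cy[b [[v _ <-] Qb]]] PQU].
exists (word_eval (@pt_letter A) u * word_eval (@pt_letter A) v); split.
  by exists (u * v) => //; exact: word_evalM.
by apply: (PQU (_, _)).
Qed.

Definition pw_mul (x y : pseudoword A) : pseudoword A :=
  SigSub (mem_set (pseudoword_set_mul (set_valP x) (set_valP y))).

Lemma pw_mulA : associative pw_mul.
Proof. by move=> x y z; apply: val_inj; exact: mulgA. Qed.

HB.instance Definition _ := isSemigroup.Build (pseudoword A) pw_mulA.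

Lemma set_val_mul :
  {morph (set_val : pseudoword A -> pt_prod A) : x y / x * y}.
Proof. by []. Qed.

Lemma pseudoword_cvg (F : set_system (pseudoword A)) (x : pseudoword A) :
  Filter F -> (forall i, F [set y | set_val y i = set_val x i]) -> F --> x.
Proof.
move=> FF Fx U [_ [[W oW <-] Wx] WU].
have nW : nbhs (set_val x : pt_prod A) W by exact: open_nbhs_nbhs.
have FW : (set_val @ F) --> (set_val x : pt_prod A) by exact: pt_prod_cvg.
exact: filterS WU (FW _ nW).
Qed.

Lemma nbhs_pseudoword (x : pseudoword A) i :
  nbhs x [set y | set_val y i = set_val x i].
Proof. exact: (@initial_continuous _ _ set_val x _ (nbhs_pt_prod _ i)). Qed.

Lemma pw_mul_continuous :
  continuous (fun xy : pseudoword A * pseudoword A => xy.1 * xy.2).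
Proof.
move=> [x y]; apply: pseudoword_cvg => i.
exists ([set z | set_val z i = set_val x i],
        [set z | set_val z i = set_val y i]).
  by split; exact: nbhs_pseudoword.
move=> [a b] [/= ax bx].
change (set_val a i * set_val b i = set_val x i * set_val y i).
by rewrite ax bx.
Qed.

Lemma pw_hausdorff : hausdorff_space (pseudoword A).
Proof.
move=> x y clxy; apply: val_inj; apply: functional_extensionality_dep => i.
have [z [zx zy]] := clxy _ _ (nbhs_pseudoword x i) (nbhs_pseudoword y i).
exact: etrans (esym zx) zy.
Qed.

Lemma pw_compact : compact [set: pseudoword A].
Proof.
have cpt : compact (@pseudoword_set A).
  apply: (@subclosed_compact _ _ [set: pt_prod A]) => //.
    exact: closed_closure.
  have := @tychonoff (pointing A) (fun i => discrete_topology (pt_sort i))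
    (fun i => setT) (fun i => @discrete_compact (pt_sort i)).
  by congr compact; rewrite eqEsubset; split.
move=> F FF _.
have Fp : F (set_val @^-1` @pseudoword_set A).
  by apply: (@filterS _ F _ setT) filterT => z _; exact: (set_valP z).
have [x [px clx]] := cpt (set_val @ F) (fmap_proper_filter _ FF) Fp.
exists (SigSub (mem_set px)); split=> // P Q FP.
move=> [_ [[W oW <-] Wx] WQ].
have nW : nbhs (x : pt_prod A) W by exact: (open_nbhs_nbhs (conj oW Wx)).
have [z [[w Pw <-] Wz]] : (set_val @` P) `&` W !=set0.
  apply: clx nW.
  by apply: (@filterS _ F _ P) FP => w Pw; exists w.
by exists w; split=> //; apply: WQ.
Qed.

Lemma pw_residual (x y : pseudoword A) : x <> y ->
  exists (T : finSemigroupType) (h : pseudoword A -> discrete_topology T),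
    [/\ continuous h, {morph h : u v / u * v} & h x <> h y].
Proof.
move=> xy; have [i xyi] : exists i, set_val x i <> set_val y i.
  apply/existsNP => e; apply: xy; apply: val_inj.
  exact: functional_extensionality_dep.
exists (pt_sort i), (fun z => set_val z i); split=> // z U /nbhs_singleton Uz.
by apply: filterS (nbhs_pseudoword z i) => w /= ->.
Qed.

HB.instance Definition _ := isProfinite.Build (pseudoword A)
  pw_mul_continuous pw_compact pw_hausdorff pw_residual.

Lemma pt_letter_pw (a : A) : pseudoword_set (@pt_letter A a).
Proof.
by apply: (@subset_closure _ (range (word_eval (@pt_letter A)))); exists (a, [::]).
Qed.

Definition letter (a : A) : pseudoword A := SigSub (mem_set (@pt_letter_pw a)).

Lemma word_dense (U : set (pseudoword A)) (x : pseudoword A) :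
  nbhs x U -> exists w : word A, U (word_eval letter w).
Proof.
move=> [_ [[W oW <-] Wx] WU].
have [_ [[w _ <-] Ww]] := set_valP x W (open_nbhs_nbhs (conj oW Wx)).
exists w; apply: WU => /=.
by rewrite (morph_word_eval _ _ set_val_mul).
Qed.

Section Lift.
Variables (S : profiniteSemigroupType) (f : A -> S).

Lemma pw_component (T : finSemigroupType) (g : A -> T) :
  exists c : pseudoword A -> T,
    [/\ continuous (c : _ -> discrete_topology T),
        {morph c : u v / u * v} & forall w, c (word_eval letter w) =
                                         word_eval g w].
Proof.
pose m (x y : 'I_#|T|) := enum_rank (enum_val x * enum_val y).
have mA : associative m.
  by move=> x y z; rewrite /m !enum_rankK mulgA.
pose i := Pointing mA (fun a => enum_rank (g a)).
pose c (z : pseudoword A) : T := enum_val (set_val z i : 'I_#|T|).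
have cm : {morph c : u v / u * v}.
  by move=> x y; rewrite /c set_val_mul /mul /= /pt_prod_mul enum_rankK.
exists c; split=> //.
  move=> z U /nbhs_singleton Uz.
  by apply: filterS (nbhs_pseudoword z i) => w /= e; rewrite /c e.
move=> w; rewrite (morph_word_eval _ _ cm); congr word_eval.
by apply/funext => a; rewrite /c /= enum_rankK.
Qed.

Lemma pw_lift_exists : exists h : pseudoword A -> S,
  [/\ continuous h, {morph h : x y / x * y} & forall a, h (letter a) = f a].
Proof.
pose G (x : pseudoword A) : set_system (word A) :=
  [set P | exists2 U, nbhs x U & word_eval letter @^-1` U `<=` P].
have GF x : ProperFilter (G x).
  split.
    by move=> [U /word_dense[w Uw]] /(_ w Uw).
  split.
  - by exists setT => //; exact: filterT.
  - move=> P Q [U nU UP] [V nV VQ]; exists (U `&` V); first exact: filterI.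
    by move=> w [Uw Vw]; split; [exact: UP|exact: VQ].
  - by move=> P Q PQ [U nU UP]; exists U => //; exact: subset_trans PQ.
have comp (T : finSemigroupType) (k : S -> discrete_topology T) :
    continuous k -> {morph k : u v / u * v} ->
    exists c : pseudoword A -> discrete_topology T,
    [/\ continuous c, {morph c : u v / u * v},
       (forall a, c (letter a) = k (f a)) &
       forall x, (word_eval f @ G x) (k @^-1` [set c x])].
  move=> kc km; have [c [cc cm ce]] := @pw_component T (k \o f).
  exists c; split=> // [a|x]; first exact: (ce (a, [::])).
  exists (c @^-1` [set c x]); first by apply: cc; exact: discrete_set1.
  by move=> w /= <-; rewrite ce (morph_word_eval _ _ km).
have cvg x : exists y : S, word_eval f @ G x --> y.
  apply: profinite_cvg => T k kc km.
  by have [c [_ _ _ /(_ x) cx]] := comp T k kc km; exists (c x).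
have [h hP] := choice cvg.
have hk (T : finSemigroupType) (k : S -> discrete_topology T)
    (c : pseudoword A -> discrete_topology T) (x : pseudoword A) :
    continuous k -> (word_eval f @ G x) (k @^-1` [set c x]) -> k (h x) = c x.
  move=> kc Gx.
  have /hP Gy : nbhs (h x) (k @^-1` [set k (h x)]).
    by apply: kc; exact: discrete_set1.
  by have [w [/= -> ->]] := filter_ex (filterI Gy Gx).
exists h; split.
- move=> x.
  apply: (@profinite_cvg_to S (h @ x) (h x) (fmap_proper_filter h (nbhs_pfilter x))) => T k kc km.
  have [c [cc _ _ cx]] := comp T k kc km.
  rewrite /= (hk T k c) //.
  have nc : nbhs x (c @^-1` [set c x]) by apply: cc; exact: discrete_set1.
  apply: (@filterS _ (nbhs x) _ (c @^-1` [set c x])) nc => z /= <-.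
  by rewrite /= (hk T k c).
- move=> x y; apply: profinite_eq => T k kc km.
  have [c [_ cm _ cx]] := comp T k kc km.
  by rewrite km !(hk T k c).
- move=> a; apply: profinite_eq => T k kc km.
  have [c [_ _ ca cx]] := comp T k kc km.
  by rewrite (hk T k c).
Qed.

Lemma pw_lift_unique (h k : pseudoword A -> S) :
  continuous h -> {morph h : x y / x * y} -> (forall a, h (letter a) = f a) ->
  continuous k -> {morph k : x y / x * y} -> (forall a, k (letter a) = f a) ->
  h = k.
Proof.
move=> hc hm hl kc km kl; apply/funext => x; apply: profinite_eq => T j jc jm.
have Uh : nbhs x (h @^-1` (j @^-1` [set j (h x)])).
  by apply: hc; apply: jc; exact: discrete_set1.
have Uk : nbhs x (k @^-1` (j @^-1` [set j (k x)])).
  by apply: kc; apply: jc; exact: discrete_set1.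
have [w [/= <- <-]] := word_dense (filterI Uh Uk).
rewrite (morph_word_eval _ _ hm) (morph_word_eval _ _ km).
by congr (j (word_eval _ w)); apply/funext => a /=; rewrite hl kl.
Qed.

Definition pw_lift : pseudoword A -> S := projT1 (cid pw_lift_exists).

Lemma pw_lift_continuous : continuous pw_lift.
Proof. by rewrite /pw_lift; case: cid => h []. Qed.

Lemma pw_liftM : {morph pw_lift : x y / x * y}.
Proof. by rewrite /pw_lift; case: cid => h []. Qed.

Lemma pw_lift_letter (a : A) : pw_lift (letter a) = f a.
Proof. by rewrite /pw_lift; case: cid => h []. Qed.

End Lift.
End FreeProfinite.

(* The operation w_S : S ^ A -> S. *)
Definition interp (A : finType) (w : pseudoword A) (S : profiniteSemigroupType)
  : (A -> S) -> S := fun f => pw_lift f w.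

(* x ^ n for n > 0. *)
Definition sg_exp (S : semigroupType) (x : S) (n : nat) : S :=
  iterop n (@mul S) x x.

Section SgExp.
Variable S : semigroupType.

Lemma sg_expS (x : S) n : sg_exp x n.+2 = x * sg_exp x n.+1.
Proof. by rewrite /sg_exp !iteropS. Qed.

Lemma morph_sg_exp (T : semigroupType) (h : S -> T) (x : S) n :
  {morph h : u v / u * v} -> h (sg_exp x n) = sg_exp (h x) n.
Proof.
by move=> hm; elim: n => [//|[//|n] IH]; rewrite !sg_expS hm IH.
Qed.

End SgExp.

Lemma sg_exp_fact (T : finSemigroupType) (s : T) :
  exists N, forall n, N <= n -> sg_exp s n`! = sg_exp s N`!.
Proof.
pose N := #|T|.
have [i [j [ij jN e]]] : exists i j, [/\ i < j, j <= N &
    sg_exp s i.+1 = sg_exp s j.+1].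
  have /injectivePn[i [j ij e]] :
      ~~ injectiveb (fun i : 'I_N.+1 => sg_exp s i.+1).
    apply/injectiveP => /leq_card; rewrite card_ord.
    by rewrite ltnn.
  wlog lt : i j ij e / i < j.
    move=> W; have := ij; rewrite neq_ltn => /orP[|] lt.
      exact: (W i j).
    by apply: (W j i) => //; rewrite eq_sym.
  by exists i, j; rewrite lt -ltnS ltn_ord.
have per m : i <= m -> sg_exp s (m + (j - i)).+1 = sg_exp s m.+1.
  elim: m => [|m IH].
    by rewrite leqn0 => /eqP i0; rewrite -{1 2}i0 (subnKC (ltnW ij)) -e.
  rewrite leq_eqVlt => /orP[/eqP <-|/IH {}IH].
    by rewrite (subnKC (ltnW ij)) e.
  by rewrite addSn !sg_expS IH.
have perk m k : i <= m -> sg_exp s (m + k * (j - i)).+1 = sg_exp s m.+1.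
  move=> im; elim: k => [|k IH]; first by rewrite mul0n addn0.
  rewrite mulSn addnCA addnC per //.
  exact: leq_trans im (leq_addr _ _).
exists N => n Nn.
have iN : i < N`!.
  by apply: leq_trans (fact_geq N); exact: leq_trans ij jN.
have dv : j - i %| n`! - N`!.
  have dN : j - i %| N`!.
    by rewrite dvdn_fact // subn_gt0 ij (leq_trans (leq_subr _ _) jN).
  rewrite dvdn_sub // dvdn_fact // subn_gt0 ij.
  by rewrite (leq_trans (leq_subr _ _)) // (leq_trans jN).
have [k ek] := dvdnP dv.
have le : N`! <= n`! by exact: leq_fact.
rewrite -(subnKC le) ek -(prednK (fact_gt0 N)) addSn perk //.
by rewrite -ltnS prednK // fact_gt0.
Qed.

Lemma omega_exists (S : profiniteSemigroupType) (x : S) :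
  exists y : S, (fun n => sg_exp x n`!) @ \oo --> y.
Proof.
apply: profinite_cvg => T h hc hm.
have [N HN] := sg_exp_fact (h x : T).
exists (sg_exp (h x) N`!); exists N => // n /= Nn.
by rewrite (morph_sg_exp _ _ hm); exact: HN.
Qed.

Definition omega (S : profiniteSemigroupType) (x : S) : S :=
  projT1 (cid (omega_exists x)).

Lemma omega_cvg (S : profiniteSemigroupType) (x : S) :
  (fun n => sg_exp x n`!) @ \oo --> omega x.
Proof. by rewrite /omega; case: cid. Qed.

(* Multiplication and x |-> x ^ omega, as pseudowords over the alphabets
   {false, true} and {tt}. *)
Definition pw_binary : pseudoword bool := letter false * letter true.
Definition pw_omega : pseudoword unit := omega (letter tt).

Record signature := Signature {
  sig_mem : forall B : finType, set (pseudoword B);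
  sig_mul : sig_mem pw_binary
}.

Variant omega_mem : forall B : finType, set (pseudoword B) :=
| OmegaBinary : omega_mem pw_binary
| OmegaPower : omega_mem pw_omega.

Definition omega_sig : signature := Signature OmegaBinary.

Inductive sigma_word (sigma : signature) (A : finType) : set (pseudoword A) :=
| SigmaLetter a : sigma_word sigma (letter a)
| SigmaOp (B : finType) (w : pseudoword B) (f : B -> pseudoword A) :
    sig_mem sigma w -> (forall b, sigma_word sigma (f b)) ->
    sigma_word sigma (interp w f).

Section DffunSemigroup.
Variables (I : finType) (S : I -> finSemigroupType).

Definition dffun_mul (f g : {dffun forall i, S i}) : {dffun forall i, S i} :=
  [ffun i => f i * g i].

Lemma dffun_mulA : associative dffun_mul.
Proof. by move=> f g h; apply/ffunP => i; rewrite !ffunE mulgA. Qed.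

HB.instance Definition _ := isSemigroup.Build {dffun forall i, S i} dffun_mulA.
End DffunSemigroup.

(* Subsemigroups are nonempty (hence the premise T), whereas the empty product
   is allowed. *)
Record pseudovariety (V : finSemigroupType -> Prop) : Prop := {
  pv_sub : forall (S T : finSemigroupType) (f : T -> S), T ->
    V S -> {morph f : x y / x * y} -> injective f -> V T;
  pv_image : forall (S T : finSemigroupType) (f : S -> T),
    V S -> {morph f : x y / x * y} -> (forall y, exists x, f x = y) -> V T;
  pv_prod : forall (I : finType) (S : I -> finSemigroupType),
    (forall i, V (S i)) -> V {dffun forall i, S i}
}.

Definition Ab (S : finSemigroupType) : Prop :=
  commutative (@mul S) /\
  exists (e : S) (inv : S -> S), left_id e (@mul S) /\ left_inverse e inv (@mul S).

Definition Com (S : finSemigroupType) : Prop := commutative (@mul S).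

Definition models (V : finSemigroupType -> Prop) (A : finType)
    (u v : pseudoword A) : Prop :=
  forall S : finSemigroupType, V S ->
    interp u (S := discrete_topology S) = interp v (S := discrete_topology S).

Definition V_solution (V : finSemigroupType -> Prop) (A : finType)
    (S : finSemigroupType) (phi : pseudoword A -> discrete_topology S) (s t : S)
    (u v : pseudoword A) : Prop :=
  [/\ models V u v, phi u = s & phi v = t].

Definition sigma_reducible (sigma : signature) (V : finSemigroupType -> Prop) : Prop :=
  forall (A : finType) (S : finSemigroupType)
    (phi : pseudoword A -> discrete_topology S),
    continuous phi -> {morph phi : x y / x * y} ->
    (forall s, exists u, phi u = s) ->
  forall s t : S,
    (exists u v, V_solution V phi s t u v) ->
    exists u v, [/\ V_solution V phi s t u v, sigma_word sigma u & sigma_word sigma v].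

(* Main.v *)
From HB Require Import structures.
From mathcomp Require Import all_boot all_fingroup.
From mathcomp Require Import monoid zmodp cyclic zify.
From mathcomp Require Import boolp classical_sets.
From mathcomp Require Import topology.
Require Import Defs.

Set Implicit Arguments.
Unset Strict Implicit.
Unset Printing Implicit Defensive.

Local Open Scope classical_set_scope.
Local Open Scope group_scope.

(** Over the alphabet {a, b}, written [true] and [false] below, consider the
    pseudowords u = (ab)^(omega-1) and v = b (abb)^(omega-1).  In a finite
    commutative semigroup both are equal to a^(omega-1) b^(omega-1), since v
    contains b with exponent 1 + 2 (omega - 1) = omega + (omega - 1).  So
    u = v holds in every pseudovariety contained in Com
    ([witnesses_agree_commutative]).

    A finite semigroup can remember that u is a product of blocks ab and that
    v is b followed by a product of blocks abb.  It is obtained from two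
    bounded counters that fail when they leave {0, 1, 2}: reading b lowers
    both of them by 1, while reading a raises the first by 1 and the second
    by 2.  A word that leads the first counter from 0 back to 0 has as many
    letters a as b; a word that leads the second from 1 to 0 has p letters a
    and 2p + 1 letters b ([counters_balance]).  As words are dense, the same
    relations hold modulo every m for the numbers of letters of pseudowords
    ([counters_act_balance]).

    Suppose that (u', v') solves x = y over a pseudovariety that contains Ab
    and has the same image as (u, v) in that semigroup.  Cyclic groups see the
    numbers of letters modulo m, so modulo every m the number p of letters a
    in u' satisfies p = 2p + 1.  For u itself p is the profinite integer -1.
    But an omega-word has a natural number p of letters outside its
    omega-powers, and the latter contribute 0 modulo every m
    ([omega_word_count]); so p + 1 = 0 modulo every m for a fixed natural
    number p, which fails for m = p + 2. *)

(** * Powers in finite semigroups *)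

Section Powers.
Variable S : semigroupType.
Implicit Types x y : S.

Lemma sg_expD x m n : 0 < m -> 0 < n ->
  sg_exp x (m + n) = sg_exp x m * sg_exp x n.
Proof.
case: m n => [//|m] [//|n] _ _; elim: m => [|m IH]; first exact: sg_expS.
by rewrite !addSn sg_expS -addSn IH [in RHS]sg_expS mulgA.
Qed.

Lemma sg_expM x m n : 0 < m -> 0 < n ->
  sg_exp x (m * n) = sg_exp (sg_exp x m) n.
Proof.
move=> m0; case: n => [//|n] _; elim: n => [|n IH]; first by rewrite muln1.
by rewrite mulnS sg_expD ?muln_gt0 ?m0 // IH sg_expS.
Qed.

Lemma sg_expMn x y n : commutative (@mul S) ->
  sg_exp (x * y) n = sg_exp x n * sg_exp y n.
Proof.
move=> C; elim: n => [//|[//|n] IH].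
rewrite !sg_expS IH !mulgA; congr (_ * _); rewrite -!mulgA; congr (_ * _).
exact: C.
Qed.

End Powers.

(** Powers with exponent n! stabilize at some e for large n, and e is
    idempotent: e = s^((n+1)!) = e^(n+1) for all large n, and comparing two
    consecutive exponents gives e e = e.  Each high power of s has e as a
    factor, hence absorbs e. *)
Lemma sg_exp_period (T : finSemigroupType) (s : T) :
  exists N, forall m n, N <= m -> N <= n -> sg_exp s (m + n`!) = sg_exp s m.
Proof.
have [N HN] := sg_exp_fact s; pose e := sg_exp s N`!.
have e_exp n : N <= n -> sg_exp e n.+1 = e.
  move=> Nn; rewrite /e -(HN n Nn) -sg_expM ?fact_gt0 //.
  by rewrite mulnC -factS !HN // leqW.
have ee : e * e = e by rewrite -{2}(e_exp N) // -sg_expS e_exp.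
exists (N`!).+1 => m n Nm Nn.
have NN := fact_geq N.
rewrite sg_expD ?fact_gt0 ?(leq_trans _ Nm) // HN; last by lia.
rewrite -(subnK (ltnW Nm)) sg_expD ?fact_gt0 ?subn_gt0 //.
by rewrite -mulgA ee.
Qed.

Lemma fact_predS n : n.+1`!.-1 = (n`!.-1 + n * n`!)%N.
Proof. by rewrite factS mulSn; have := fact_gt0 n; lia. Qed.

(** Passing from n! - 1 to (n+1)! - 1 adds n times the period n!. *)
Lemma sg_exp_fact_pred (T : finSemigroupType) (s : T) :
  exists N, forall n, N <= n -> sg_exp s n`!.-1 = sg_exp s N`!.-1.
Proof.
have [N HN] := sg_exp_period s.
exists N.+1; elim=> [//|n IH]; rewrite leq_eqVlt => /predU1P[<- //|].
rewrite ltnS => Nn; rewrite -IH // fact_predS.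
have Nf : N <= n`!.-1 by have := fact_geq n; lia.
have Nn' : N <= n by lia.
elim: {2}n => [|k IHk]; first by rewrite addn0.
by rewrite mulSn addnCA addnC HN ?IHk // (leq_trans Nf) ?leq_addr.
Qed.

(** * The power omega - 1 *)

Lemma cvg_hom_eventually (S : profiniteSemigroupType) (T : finSemigroupType)
    (h : S -> discrete_topology T) (f : nat -> S) (y : S) :
  continuous h -> f @ \oo --> y -> exists N, forall n, N <= n -> h (f n) = h y.
Proof.
move=> hc fy; have /fy[N _ HN] : nbhs y (h @^-1` [set h y]).
  by apply: hc; exact: discrete_set1.
by exists N => n Nn; exact: HN.
Qed.

Lemma omega_hom (S : profiniteSemigroupType) (T : finSemigroupType)
    (h : S -> discrete_topology T) (x : S) :
  continuous h -> {morph h : u v / u * v} ->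
  exists N, forall n, N <= n -> h (omega x) = sg_exp (h x : T) n`!.
Proof.
move=> hc hm; have [N HN] := cvg_hom_eventually hc (omega_cvg (x := x)).
by exists N => n /HN <-; exact: (morph_sg_exp _ _ hm).
Qed.

Lemma omega_pred_exists (S : profiniteSemigroupType) (x : S) :
  exists y : S, (fun n => sg_exp x n`!.-1) @ \oo --> y.
Proof.
apply: profinite_cvg => T h hc hm.
have [N HN] := sg_exp_fact_pred (h x : T).
exists (sg_exp (h x) N`!.-1); exists N => // n /= Nn.
by rewrite (morph_sg_exp _ _ hm); exact: HN.
Qed.

Definition omega_pred (S : profiniteSemigroupType) (x : S) : S :=
  projT1 (cid (omega_pred_exists x)).

Lemma omega_pred_hom (S : profiniteSemigroupType) (T : finSemigroupType)
    (h : S -> discrete_topology T) (x : S) :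
  continuous h -> {morph h : u v / u * v} ->
  exists N, forall n, N <= n -> h (omega_pred x) = sg_exp (h x : T) n`!.-1.
Proof.
move=> hc hm; rewrite /omega_pred; case: cid => y /= xy.
have [N HN] := cvg_hom_eventually hc xy.
by exists N => n /HN <-; exact: (morph_sg_exp _ _ hm).
Qed.

(** * Approximating pseudowords by words *)

Definition letters (A : Type) (w : word A) : seq A := w.1 :: w.2.

Lemma word_rcons_ind (A : choiceType) (P : word A -> Prop) :
  (forall c, P (c, [::])) -> (forall w c, P w -> P (w * (c, [::]))) ->
  forall w, P w.
Proof.
move=> P1 PM [c s]; elim/last_ind: s => [//|s d IH].
by rewrite -cats1; exact: (PM (c, s) d IH).
Qed.

Lemma letters_mul (A : choiceType) (u v : word A) :
  letters (u * v) = letters u ++ letters v.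
Proof. by []. Qed.

Lemma pw_lift_word (A : finType) (S : profiniteSemigroupType) (f : A -> S)
    (w : word A) : pw_lift f (word_eval (@letter A) w) = word_eval f w.
Proof.
rewrite (morph_word_eval _ _ (@pw_liftM A S f)); congr word_eval.
by apply/funext => a /=; rewrite pw_lift_letter.
Qed.

(** By density of words, identities between numbers of letters that are true
    for words pass to pseudowords; one word has to serve the counters and the
    numbers of both letters at the same time. *)
Lemma pw_word_approx (A : finType) (T1 T2 T3 : finSemigroupType)
    (f1 : A -> discrete_topology T1) (f2 : A -> discrete_topology T2)
    (f3 : A -> discrete_topology T3) (u : pseudoword A) :
  exists w : word A, [/\ pw_lift f1 u = word_eval f1 w,
    pw_lift f2 u = word_eval f2 w & pw_lift f3 u = word_eval f3 w].
Proof.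
have nb (T : finSemigroupType) (f : A -> discrete_topology T) :
    nbhs u (pw_lift f @^-1` [set pw_lift f u]).
  by apply: pw_lift_continuous; exact: discrete_set1.
have [w [[/= e1 e2] e3]] :=
  word_dense (filterI (filterI (nb _ f1) (nb _ f2)) (nb _ f3)).
by exists w; split; rewrite -pw_lift_word.
Qed.

(** * Counting letters modulo m *)

HB.instance Definition _ m := Semigroup.on 'I_m.+1.

(** The generator of the cyclic group stands for [a] and the identity for the
    other letters, so that the product over a word is the number of its
    letters [a]; the group is written multiplicatively. *)
Definition mark (A : finType) m (a : A) : A -> discrete_topology 'I_m.+1 :=
  fun c => (Zp1 : 'I_m.+1) ^+ (c == a).

Definition count_mod (A : finType) m (a : A) (u : pseudoword A) : 'I_m.+1 :=
  pw_lift (mark m a) u.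

Lemma word_eval_mark (A : finType) m (a : A) (w : word A) :
  word_eval (mark m a) w = (Zp1 : 'I_m.+1) ^+ count_mem a (letters w).
Proof.
elim/word_rcons_ind: w => [c|w c IH]; first by rewrite /= addn0; exact: erefl.
have -> : count_mem a (letters (w * (c, [::]))) =
    (count_mem a (letters w) + (c == a))%N.
  by rewrite letters_mul count_cat; congr addn; exact: addn0.
rewrite (word_evalM (A := A)) IH [RHS]expgnDr.
exact: erefl.
Qed.

Lemma sg_exp_fact_cyclic m (x : 'I_m.+1) n : m < n -> sg_exp x n`! = 1.
Proof.
move=> mn; have -> : sg_exp x n`! = x ^+ n`!.
  by case: (_`!) (fact_gt0 n) => // k _; rewrite /sg_exp /natexp !iteropS.
apply/eqP; rewrite -order_dvdn (@dvdn_trans m.+1) ?dvdn_fact //.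
by have := order_dvdG (finset.in_setT x); rewrite cardsT card_ord.
Qed.

Lemma count_mod_omega (A : finType) (f : unit -> pseudoword A) m (a : A) :
  count_mod m a (interp pw_omega f) = 1.
Proof.
pose h (x : pseudoword unit) := pw_lift (mark m a) (pw_lift f x).
have hc : continuous h.
  by move=> x; apply: continuous_comp; exact: pw_lift_continuous.
have hm : {morph h : u v / u * v} by move=> x y; rewrite /h !pw_liftM.
have [N HN] := omega_hom (letter tt) hc hm.
rewrite /count_mod -[LHS]/(h (omega (letter tt))).
rewrite (HN (N + m.+1)%N) ?leq_addr //.
by apply: sg_exp_fact_cyclic; rewrite leq_addl.
Qed.

(** The natural number n is the number of occurrences of [a] outside the
    omega-powers; that it does not depend on m is what separates omega-words
    from pseudowords such as a^(omega-1). *)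
Lemma omega_word_count (A : finType) (a : A) (u : pseudoword A) :
  sigma_word omega_sig u ->
  exists n, forall m, count_mod m a u = (Zp1 : 'I_m.+1) ^+ n.
Proof.
elim=> [b|B w f Bw _ IH].
  by exists (b == a) => m; rewrite /count_mod pw_lift_letter.
case: B w / Bw f IH => f IH; last by exists 0 => m; exact: count_mod_omega.
have [n1 H1] := IH false; have [n2 H2] := IH true.
exists (n1 + n2)%N => m; rewrite expgnDr -H1 -H2.
by rewrite /count_mod /interp /pw_binary pw_liftM !pw_lift_letter pw_liftM.
Qed.

(** * Transformations and image semigroups *)

Definition transformation (Q : finType) : Type := {ffun Q -> Q}.

HB.instance Definition _ (Q : finType) := Finite.on (transformation Q).

(** The left factor acts first: words act by reading from left to right. *)
Definition transformation_mul (Q : finType) (f g : transformation Q) :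
  transformation Q := [ffun q => g (f q)].

Lemma transformation_mulA (Q : finType) : associative (@transformation_mul Q).
Proof. by move=> f g h; apply/ffunP => q; rewrite !ffunE. Qed.

HB.instance Definition _ (Q : finType) :=
  isSemigroup.Build (transformation Q) (@transformation_mulA Q).

Lemma transformation_mulE (Q : finType) (f g : transformation Q) q :
  (f * g) q = g (f q).
Proof. by rewrite ffunE. Qed.

Lemma transformation_exp_fix (Q : finType) (f : transformation Q) q n :
  f q = q -> (sg_exp f n : transformation Q) q = q.
Proof.
by move=> fq; elim: n => [//|[//|n] IH]; rewrite sg_expS transformation_mulE fq.
Qed.

(** Reducibility concerns onto homomorphisms; the image makes one out of a
    homomorphism into a full transformation semigroup. *)
Section Image.
Variables (S : semigroupType) (T : finSemigroupType) (f : S -> T).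
Hypothesis fM : {morph f : x y / x * y}.

(** The argument is only a tag from which the semigroup structure of the image
    is inferred. *)
Definition hom_image of {morph f : x y / x * y} : Type :=
  {y : T | `[< exists x, f x = y >]}.
Local Notation im := (hom_image fM).

HB.instance Definition _ := SubFinite.on im.

Lemma image_mul_subproof (y z : im) : `[< exists x, f x = val y * val z >].
Proof.
have [/asboolP[x xy] /asboolP[x' xz]] := (svalP y, svalP z).
by apply/asboolP; exists (x * x'); rewrite fM xy xz.
Qed.

Definition image_mul (y z : im) : im :=
  Sub (val y * val z) (image_mul_subproof y z).

Lemma image_mulA : associative image_mul.
Proof. by move=> x y z; apply: val_inj; exact: mulgA. Qed.

HB.instance Definition _ := isSemigroup.Build im image_mulA.

Lemma to_image_subproof x : `[< exists x', f x' = f x >].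
Proof. by apply/asboolP; exists x. Qed.

Definition to_image (x : S) : im := Sub (f x) (to_image_subproof x).

Lemma to_imageM : {morph to_image : x y / x * y}.
Proof. by move=> x y; apply: val_inj; exact: fM. Qed.

Lemma to_image_onto y : exists x, to_image x = y.
Proof.
by case: y => y /[dup] /asboolP[x xy] yP; exists x; apply: val_inj.
Qed.

End Image.

Lemma to_image_continuous (S : profiniteSemigroupType) (T : finSemigroupType)
    (f : S -> discrete_topology T) (fM : {morph (f : S -> T) : x y / x * y}) :
  continuous f ->
  continuous (to_image fM : S -> discrete_topology (hom_image fM)).
Proof.
move=> fc x U /nbhs_singleton Ux.
have : nbhs x (f @^-1` [set f x]) by apply: fc; exact: discrete_set1.
apply: filterS => z /= zx; suff -> : to_image fM z = to_image fM x by [].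
exact: val_inj.
Qed.

(** * Bounded counters *)

(** [None] is the failure state.  The counter with index [k] gains [k.+1] on
    reading [true] and loses 1 on reading [false]. *)
Definition counter_step (k c : bool) (i : 'I_3) : option 'I_3 :=
  if c then insub (i + k.+1)%N else if val i is j.+1 then insub j else None.

Definition counters (c : bool) : transformation (bool * option 'I_3)%type :=
  [ffun q => (q.1, obind (counter_step q.1 c) q.2)].

Definition counters_run (w : word bool) :
    transformation (bool * option 'I_3)%type := word_eval counters w.

Lemma counters_run_rcons (w : word bool) c q : counters_run (w * (c, [::])) q =
  ((counters_run w q).1,
   obind (counter_step (counters_run w q).1 c) (counters_run w q).2).
Proof.
rewrite /counters_run (word_evalM (A := bool)) transformation_mulE.
exact: ffunE.
Qed.

(** Since a counter that fails stays in its failure state, the difference of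
    its final and initial values is the sum of all the steps. *)
Lemma counters_balance (w : word bool) k (i j : 'I_3) :
  counters_run w (k, Some i) = (k, Some j) ->
  (i + k.+1 * count_mem true (letters w) = j + count_mem false (letters w))%N.
Proof.
have step k' c (i' j' : 'I_3) : counter_step k' c i' = Some j' ->
    (i' + k'.+1 * (c == true) = j' + (c == false))%N.
  rewrite /counter_step; case: c => /=.
    by case: insubP => // x _ xE [<-]; rewrite xE; lia.
  case: i' => -[//|i'] /= ?; case: insubP => // x _ /= xE [<-].
  by rewrite xE; lia.
elim/word_rcons_ind: w j => [c|w c IH] j.
  rewrite /counters_run /word_eval /= ffunE /= => -[] /step; lia.
rewrite counters_run_rcons letters_mul !count_cat.
case E : (counters_run w _) => [k' [i'|//]] /= [k'k] /step.
by rewrite k'k in E *; have := IH _ E; rewrite /=; lia.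
Qed.

Lemma counter_up (k : bool) (i j : 'I_3) :
  j = (i + k.+1)%N :> nat -> counter_step k true i = Some j.
Proof. by rewrite /counter_step => <-; exact: valK. Qed.

Lemma counter_down k (i j : 'I_3) :
  i = j.+1 :> nat -> counter_step k false i = Some j.
Proof. by rewrite /counter_step /= => ->; exact: valK. Qed.

Definition counters_hom (u : pseudoword bool) :
    discrete_topology (transformation (bool * option 'I_3)%type) :=
  pw_lift (counters : bool -> discrete_topology _) u.

Lemma counters_hom_continuous : continuous counters_hom.
Proof. exact: pw_lift_continuous. Qed.

Lemma counters_homM : {morph counters_hom : u v / u * v}.
Proof. exact: pw_liftM. Qed.

Definition counters_act (u : pseudoword bool) :
    bool * option 'I_3 -> bool * option 'I_3 :=
  (counters_hom u : transformation (bool * option 'I_3)%type).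

Lemma counters_actM u v q :
  counters_act (u * v) q = counters_act v (counters_act u q).
Proof. by rewrite /counters_act counters_homM; exact: transformation_mulE. Qed.

Lemma counters_act_letter c k i :
  counters_act (letter c) (k, Some i) = (k, counter_step k c i).
Proof. by rewrite /counters_act /counters_hom pw_lift_letter; exact: ffunE. Qed.

Lemma counters_act_omega_pred u q :
  counters_act u q = q -> counters_act (omega_pred u) q = q.
Proof.
move=> uq.
have [N HN] := omega_pred_hom u counters_hom_continuous counters_homM.
by rewrite /counters_act (HN N) //; exact: transformation_exp_fix.
Qed.

(** * A pair of pseudowords that agree in commutative semigroups *)

Definition witness_u : pseudoword bool :=
  omega_pred (letter true * letter false).

Definition witness_v : pseudoword bool :=
  letter false * omega_pred (letter true * letter false * letter false).

Lemma witnesses_agree_commutative (V : finSemigroupType -> Prop) :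
  (forall S, V S -> Com S) -> models V witness_u witness_v.
Proof.
move=> VC T /VC C; apply/funext => f; rewrite /interp /witness_u /witness_v.
have hc := @pw_lift_continuous _ _ f; have hm := @pw_liftM _ _ f.
have [N1 H1] := omega_pred_hom (letter true * letter false) hc hm.
have [N2 H2] :=
  omega_pred_hom (letter true * letter false * letter false) hc hm.
rewrite hm; pose x : T := f true; pose y : T := f false.
have [N3 H3] := sg_exp_period y.
(* The summand 2 makes the exponent n! - 1 positive, as needed for laws of
   exponents in a semigroup without identity. *)
pose n := (N1 + N2 + N3 + 2)%N.
have n2 : 2 <= n by rewrite leq_addl.
rewrite (H1 n) 1?(H2 n) ?hm ?pw_lift_letter; try (rewrite /n; lia).
have n0 : n`! = n`!.-1.+1 by rewrite prednK ?fact_gt0.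
have m0 : 0 < n`!.-1 by have := fact_geq n; lia.
rewrite -[LHS]/(sg_exp (x * y) n`!.-1) -[RHS]/(y * sg_exp (x * y * y) n`!.-1).
have -> : y * sg_exp (x * y * y) n`!.-1 =
    sg_exp x n`!.-1 * sg_exp y (n`!.-1 + n`!).
  rewrite !sg_expMn // C sg_expD ?fact_gt0 // -!mulgA; do 2!congr (_ * _).
  by rewrite [in RHS]n0 -addn1 sg_expD.
rewrite H3 ?sg_expMn //; have := fact_geq n; rewrite /n; lia.
Qed.

Definition i0 : 'I_3 := @Ordinal 3 0 isT.
Definition i1 : 'I_3 := @Ordinal 3 1 isT.
Definition i2 : 'I_3 := @Ordinal 3 2 isT.

Lemma counters_witness_u :
  counters_act witness_u (false, Some i0) = (false, Some i0).
Proof.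
apply: counters_act_omega_pred.
rewrite counters_actM !counters_act_letter (@counter_up _ _ i1) //.
by rewrite counters_act_letter (@counter_down _ _ i0).
Qed.

Lemma counters_witness_v :
  counters_act witness_v (true, Some i1) = (true, Some i0).
Proof.
rewrite counters_actM counters_act_letter (@counter_down _ _ i0) //.
apply: counters_act_omega_pred.
rewrite !counters_actM counters_act_letter (@counter_up _ _ i2) //.
rewrite counters_act_letter (@counter_down _ _ i1) //.
by rewrite counters_act_letter (@counter_down _ _ i0).
Qed.

(** * Letter counts forced by the counters *)

(** Values of counters are natural numbers and letter counts of pseudowords
    are profinite; the balance makes sense for both in the cyclic groups. *)
Lemma counters_act_balance m (u : pseudoword bool) k (i j : 'I_3) :
  counters_act u (k, Some i) = (k, Some j) ->
  (Zp1 : 'I_m.+1) ^+ i * count_mod m true u ^+ k.+1 =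
  (Zp1 : 'I_m.+1) ^+ j * count_mod m false u.
Proof.
have [w [wc wt wf]] := pw_word_approx (counters : bool -> discrete_topology _)
  (mark m true) (mark m false) u.
rewrite /counters_act /counters_hom wc => /counters_balance e.
rewrite /count_mod wt wf !word_eval_mark -expgnA -!expgnDr -e.
by congr (_ ^+ (_ + _)); exact: mulnC.
Qed.

Lemma cyclic_Ab m : Ab 'I_m.+1.
Proof.
split; first exact: Zp_addC.
by exists 1, invg; split; [exact: mul1g|exact: mulVg].
Qed.

Theorem theorem4 (V : finSemigroupType -> Prop) :
  pseudovariety V ->
  (forall S : finSemigroupType, Ab S -> V S) ->
  (forall S : finSemigroupType, V S -> Com S) ->
  ~ sigma_reducible omega_sig V.
Proof.
move=> _ AbV VC red.
pose psi : pseudoword bool -> discrete_topology (hom_image counters_homM) :=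
  to_image counters_homM.
have sol : V_solution V psi (psi witness_u) (psi witness_v) witness_u witness_v.
  by split=> //; exact: witnesses_agree_commutative.
have [u [v [[uv us vt] u_omega _]]] := red _ _ psi
  (to_image_continuous counters_hom_continuous)
  (to_imageM counters_homM) (@to_image_onto _ _ _ counters_homM) _ _
  (ex_intro _ _ (ex_intro _ _ sol)).
have [n un] := omega_word_count true u_omega.
have act_psi x y : psi x = psi y -> counters_act x = counters_act y.
  move=> /(congr1 (fun z : hom_image counters_homM => val z)) xy.
  by rewrite /counters_act; congr (fun_of_fin _); exact: xy.
have act_u : counters_act u (false, Some i0) = (false, Some i0).
  by rewrite (act_psi _ _ us) counters_witness_u.
have act_v : counters_act v (true, Some i1) = (true, Some i0).
  by rewrite (act_psi _ _ vt) counters_witness_v.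
(* The modulus is n + 2, for which n + 1 is not 0. *)
have count_uv c : count_mod n.+1 c u = count_mod n.+1 c v.
  have := uv 'I_n.+2 (AbV _ (cyclic_Ab _)).
  by move=> /(congr1 (fun F => F (mark n.+1 c))).
(* With p the common image of the numbers of letters, the two balances are
   p(true) = p(false) and 1 + 2 p(true) = p(false). *)
have := counters_act_balance n.+1 act_u.
have := counters_act_balance n.+1 act_v.
rewrite -!count_uv un /= !expg0 !mul1g !expg1 => <- e.
have /mulIg : (Zp1 : 'I_n.+2) * Zp1 ^+ n * Zp1 ^+ n = 1 * Zp1 ^+ n.
  by rewrite mul1g [RHS]e expgS expg1 mulgA.
by rewrite -expgS => /eqP; rewrite -order_dvdn order_Zp1 gtnNdvd.
Qed.
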